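(* Given a suffix AVL tree $\mathrm{SAVL}$ of a text $T$ for a set of positions $P$, the sparse LCP array $\mathrm{SLCP}$ of $T$ with respect to $P$ can be computed in time linear in the number of nodes of $\mathrm{SAVL}$.
   Context: Let $T[1..n]$ be a text, $T[p..]$ its suffix starting at position $p$, $\prec$ the lexicographic order on strings, and $\mathrm{lcp}(X,Y)$ the length of the longest common prefix of strings $X,Y$. Let $P=\{p_1,\dots,p_m\}\subseteq[1..n]$. The sparse suffix array $\mathrm{SSA}[1..m]$ lists the positions of $P$ so that $T[\mathrm{SSA}[i]..]\prec T[\mathrm{SSA}[i+1]..]$ for all $i$. The sparse LCP array is defined by $\mathrm{SLCP}[1]=0$ and $\mathrm{SLCP}[i]=\mathrm{lcp}(T[\mathrm{SSA}[i-1]..],T[\mathrm{SSA}[i]..])$ for $i\in[2..m]$. A suffix AVL tree $\mathrm{SAVL}$ for $P$ is a binary search tree whose nodes are the positions of $P$ (identified with the suffixes they start) such that an in-order traversal yields $\mathrm{SSA}$ (it may, but need not, be balanced as an AVL tree). For a node $v$, $\mathrm{cla}_v$ (resp. $\mathrm{cra}_v$) is the lowest node having $v$ as a descendant in its left (resp. right) subtree, if it exists. Each node $v$ stores a pair $(d_v,m_v)$ with $d_v\in\{\mathtt{left},\mathtt{right},\bot\}$: $m_v=\mathrm{lcp}(T[v..],T[\mathrm{cla}_v..])$ if $d_v=\mathtt{left}$, $m_v=\mathrm{lcp}(T[v..],T[\mathrm{cra}_v..])$ if $d_v=\mathtt{right}$, and $m_v=0$ if $d_v=\bot$, where $d_v$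 is chosen (among the existing options) so that $m_v$ is maximized. The tree stores only this information (node positions, tree pointers, and the pairs $(d_v,m_v)$). *)

(* Defs.v *)
From mathcomp Require Import all_boot all_order.

Set Implicit Arguments.
Unset Strict Implicit.
Unset Printing Implicit Defensive.

Fixpoint lcp (A : eqType) (s t : seq A) : nat :=
  match s, t with
  | x :: s', y :: t' => if x == y then (lcp s' t').+1 else 0
  | _, _ => 0
  end.

(* T[p..]; positions are 1-based. *)
Definition suffix_at (A : Type) (T : seq A) (p : nat) : seq A := drop p.-1 T.

(* seqlexi is the lexicographic order in which a proper prefix of a
   string is smaller than the string. *)
Definition lex_lt (disp : Order.disp_t) (A : orderType disp) (s t : seq A) : bool :=
  ((s : seqlexi A) < (t : seqlexi A))%O.

Definition suffix_lcp (A : eqType) (T : seq A) (p q : nat) : nat :=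
  lcp (suffix_at T p) (suffix_at T q).

Definition is_SSA (disp : Order.disp_t) (A : orderType disp) (T : seq A)
    (P ssa : seq nat) : bool :=
  perm_eq ssa P &&
  sorted (fun p q => lex_lt (suffix_at T p) (suffix_at T q)) ssa.

(* Lists are 0-based, so SLCP[i] is entry i.-1 of this list. *)
Definition SLCP (A : eqType) (T : seq A) (ssa : seq nat) : seq nat :=
  if ssa is p :: ssa' then 0 :: pairmap (suffix_lcp T) p ssa' else [::].

Inductive dir := DirLeft | DirRight | DirBot.

(* Node l v d m r is the node for position v, with subtrees l and r and stored
   pair (d_v, m_v) = (d, m); Leaf is the absent subtree. *)
Inductive tree :=
  | Leaf
  | Node (l : tree) (v : nat) (d : dir) (m : nat) (r : tree).

Fixpoint inorder (t : tree) : seq nat :=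
  if t is Node l v _ _ r then inorder l ++ v :: inorder r else [::].

Definition num_nodes (t : tree) : nat := size (inorder t).

Fixpoint cla (t : tree) (v : nat) : option nat :=
  if t is Node l u _ _ r then
    if v \in inorder l then Some (odflt u (cla l v)) else cla r v
  else None.

Fixpoint cra (t : tree) (v : nat) : option nat :=
  if t is Node l u _ _ r then
    if v \in inorder r then Some (odflt u (cra r v)) else cra l v
  else None.

(* The value m_v prescribed by the choice d_v = d; None if the ancestor that d
   refers to does not exist. *)
Definition dir_lcp (A : eqType) (T : seq A) (t : tree) (v : nat) (d : dir) :
    option nat :=
  match d with
  | DirLeft => omap (suffix_lcp T v) (cla t v)
  | DirRight => omap (suffix_lcp T v) (cra t v)
  | DirBot => Some 0
  end.

Definition pair_ok (A : eqType) (T : seq A) (t : tree) (v : nat) (d : dir)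
    (m : nat) : Prop :=
  dir_lcp T t v d = Some m /\
  forall d' m', dir_lcp T t v d' = Some m' -> m' <= m.

Fixpoint all_nodes (Q : nat -> dir -> nat -> Prop) (t : tree) : Prop :=
  if t is Node l v d m r then [/\ all_nodes Q l, Q v d m & all_nodes Q r]
  else True.

Definition is_SAVL (disp : Order.disp_t) (A : orderType disp) (T : seq A)
    (P : seq nat) (t : tree) : Prop :=
  is_SSA T P (inorder t) /\ all_nodes (pair_ok T t) t.

(* A word RAM with w-bit words.  Register and memory contents are naturals kept
   below 2 ^ w, arithmetic is modulo 2 ^ w, and a program is a fixed list of
   instructions, independent of w and of the input.  Only registers named in the
   program are used, hence finitely many.  Each executed instruction costs 1. *)
Inductive instr :=
  | IConst (r k : nat)
  | IMove (r a : nat)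
  | IAdd (r a b : nat)
  | ISub (r a b : nat)
  | IFetch (r a : nat)
  | IStore (a b : nat)
  | IJump (l : nat)
  | IJumpEq (a b l : nat)
  | IJumpLt (a b l : nat)
  | IHalt.

Record state := State { pc : nat; reg : nat -> nat; memory : nat -> nat }.

Definition upd (f : nat -> nat) (i x : nat) : nat -> nat :=
  fun j => if j == i then x else f j.

(* None means that the machine has halted; leaving the program also halts. *)
Definition step (w : nat) (prog : seq instr) (s : state) : option state :=
  let R := reg s in
  let M := memory s in
  let set_reg r x := Some (State (pc s).+1 (upd R r (x %% 2 ^ w)) M) in
  let goto l := Some (State l R M) in
  match nth IHalt prog (pc s) with
  | IConst r k => set_reg r k
  | IMove r a => set_reg r (R a)
  | IAdd r a b => set_reg r (R a + R b)
  | ISub r a b => set_reg r (R a + (2 ^ w - R b))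
  | IFetch r a => set_reg r (M (R a))
  | IStore a b => Some (State (pc s).+1 R (upd M (R a) (R b)))
  | IJump l => goto l
  | IJumpEq a b l => goto (if R a == R b then l else (pc s).+1)
  | IJumpLt a b l => goto (if R a < R b then l else (pc s).+1)
  | IHalt => None
  end.

Fixpoint run (w : nat) (prog : seq instr) (k : nat) (s : state) : state :=
  if k is k'.+1 then
    if step w prog s is Some s' then run w prog k' s' else s
  else s.

Definition halted (w : nat) (prog : seq instr) (s : state) : Prop :=
  step w prog s = None.

Definition dir_code (d : dir) : nat :=
  match d with DirLeft => 0 | DirRight => 1 | DirBot => 2 end.

(* M holds t as a linked structure with root pointer a, inside the addresses
   below b.  A node is a record of five consecutive words: position, left
   pointer, right pointer, d_v, m_v; the null pointer is 0. *)
Fixpoint stored (M : nat -> nat) (b a : nat) (t : tree) : Prop :=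
  if t is Node l v d m r then
    [/\ 0 < a /\ a + 5 <= b,
        [/\ M a = v, M (a + 3) = dir_code d & M (a + 4) = m],
        stored M b (M (a + 1)) l
      & stored M b (M (a + 2)) r]
  else a = 0.

(* Register 0 points to the root and register 1 to the start of the free memory;
   everything else, including the free memory, has arbitrary contents. *)
Definition input_state (w : nat) (t : tree) (s : state) : Prop :=
  [/\ pc s = 0,
      forall r, reg s r < 2 ^ w,
      forall a, memory s a < 2 ^ w
    & stored (memory s) (reg s 1) (reg s 0) t].

(* Register 0 points to an array with contents x. *)
Definition output_array (w : nat) (x : seq nat) (s : state) : Prop :=
  reg s 0 + size x <= 2 ^ w /\
  forall i, i < size x -> memory s (reg s 0 + i) = nth 0 x i.

(* Main.v *)
(** Along a root path keep [e], the lcp of the two suffixes delimiting the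
    current subtree (0 if one of them is missing).  Lexicographic order makes [e]
    the minimum of the lcps of the root [v] with the two delimiters, while [m_v]
    is their maximum and [d_v] tells on which side it is attained; so both lcps
    are known and delimit the two subtrees of [v].  At an absent subtree the
    delimiters are neighbours in SSA, and [e] is an entry of SLCP.  The RAM
    program traverses the tree in order: it writes the output upwards from the
    start of the free memory and keeps the pending right subtrees on a stack
    growing downwards from the last address. *)
Require Import Defs.
From mathcomp Require Import all_boot all_order.
From mathcomp Require Import zify.

Set Implicit Arguments.
Unset Strict Implicit.
Unset Printing Implicit Defensive.

Import Order.TTheory.

(** * Computing SLCP by tree recursion *)

Lemma lcpC (A : eqType) (s t : seq A) : lcp s t = lcp t s.
Proof. by elim: s t => [|x s IH] [|y t] //=; rewrite eq_sym IH. Qed.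

(** Without the order, [s] and [u] could agree at a position where both differ from [t]. Here the
    characters at such a position satisfy [x < y < z], so [s] and [u] part there as well. *)
Lemma lcp_between (disp : Order.disp_t) (A : orderType disp) (s t u : seq A) :
  lex_lt s t -> lex_lt t u -> lcp s u = minn (lcp s t) (lcp t u).
Proof.
rewrite /lex_lt; elim: s t u => [|x s IH] [|y t] [|z u] //=; rewrite ?min0n ?minn0 //.
rewrite !ltxi_cons => /andP[xy /implyP st] /andP[yz /implyP tu].
have [exy|nxy] := eqVneq x y; have [eyz|nyz] := eqVneq y z; subst.
- by rewrite eqxx (IH t u) ?minnSS ?st ?tu.
- by rewrite (negPf nyz) minn0.
- by rewrite (negPf nxy) min0n.
- have xz : (x < z)%O by apply: lt_trans (_ : y < z)%O; rewrite lt_neqAle ?nxy ?nyz.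
  by rewrite (lt_eqF xz).
Qed.

(** For the root itself [cla] continues into the right subtree; this is what shows that a root has
    no such ancestor. *)
Lemma cla_notin (t : tree) v : v \notin inorder t -> cla t v = None.
Proof.
elim: t => //= l _ u d m r IHr; rewrite mem_cat in_cons !negb_or.
by move=> /and3P[/negPf-> _ /IHr].
Qed.

Lemma cra_notin (t : tree) v : v \notin inorder t -> cra t v = None.
Proof.
elim: t => //= l IHl u d m r _; rewrite mem_cat in_cons !negb_or.
by move=> /and3P[/IHl ? _ /negPf->].
Qed.

Definition is_left (d : dir) : bool := if d is DirLeft then true else false.

(** One entry per absent subtree, from left to right. [DirBot] may share the branch of [DirRight]:
    in a correct pair, 0 is then the maximal lcp, so both lcps with the delimiters are 0, and so is
    [e]. *)
Fixpoint gap_lcps (t : tree) (e : nat) : seq nat :=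
  if t is Node l _ d m r then
    gap_lcps l (if is_left d then e else m) ++
    gap_lcps r (if is_left d then m else e)
  else [:: e].

Lemma size_gap_lcps t e : size (gap_lcps t e) = (num_nodes t).+1.
Proof.
rewrite /num_nodes; elim: t e => //= l IHl v d m r IHr e.
by rewrite !size_cat IHl IHr /= addSn.
Qed.

Section GapLcps.
Variables (disp : Order.disp_t) (A : orderType disp) (T : seq A).

Let slt p q := lex_lt (suffix_at T p) (suffix_at T q).

Lemma suffix_ltxx : irreflexive slt.
Proof. by move=> p; rewrite /slt /lex_lt ltxx. Qed.

Lemma suffix_lt_trans : transitive slt.
Proof. by move=> q p r; rewrite /slt /lex_lt; apply: lt_trans. Qed.

(* [None] is a missing delimiter, on either side. *)
Definition olcp (x y : option nat) : nat :=
  if x is Some p then if y is Some q then suffix_lcp T p q else 0 else 0.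

(** The pairs refer to ancestors in all of [t], while the induction runs over subtrees [u]. The
    first two hypotheses express that ancestors outside [u] enter only through the delimiters [hi]
    and [lo]. *)
Lemma gap_lcpsE (t u : tree) (lo hi : option nat) :
  (forall v, v \in inorder u -> cla t v = if cla u v is Some c then Some c else hi) ->
  (forall v, v \in inorder u -> cra t v = if cra u v is Some c then Some c else lo) ->
  all_nodes (pair_ok T t) u ->
  pairwise slt (inorder u) ->
  (forall v p, v \in inorder u -> lo = Some p -> slt p v) ->
  (forall v p, v \in inorder u -> hi = Some p -> slt v p) ->
  gap_lcps u (olcp lo hi) = pairmap olcp lo (rcons (map Some (inorder u)) hi).
Proof.
elim: u lo hi => [|l IHl v d m r IHr] lo hi //= Hcla Hcra [okl [okm okmax] okr].
rewrite pairwise_cat /= allrel_consr => /and3P[/andP[lv lr] pl /andP[vr pr]] Hlo Hhi.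
have {}lv x : x \in inorder l -> slt x v by move/allP: lv; apply.
have {}vr x : x \in inorder r -> slt v x by move/allP: vr; apply.
have {}lr x : x \in inorder l -> x \in inorder r = false.
  move=> xl; apply/negP => xr; move/allrelP: lr => /(_ _ _ xl xr).
  by rewrite suffix_ltxx.
have vl : v \in inorder l = false.
  by apply/negP => /lv; rewrite suffix_ltxx.
have vNr : v \in inorder r = false.
  by apply/negP => /vr; rewrite suffix_ltxx.
have vin : v \in inorder l ++ v :: inorder r by rewrite mem_cat mem_head orbT.
have inl x : x \in inorder l -> x \in inorder l ++ v :: inorder r.
  by rewrite mem_cat => ->.
have inr x : x \in inorder r -> x \in inorder l ++ v :: inorder r.
  by rewrite mem_cat in_cons => ->; rewrite !orbT.
have cv : cla t v = hi by rewrite Hcla // vl cla_notin // vNr.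
have rv : cra t v = lo by rewrite Hcra // vNr cra_notin // vl.
have olcpC x y : suffix_lcp T x y = suffix_lcp T y x by apply: lcpC.
(* If a delimiter is missing, both sides are 0. *)
have minE : olcp lo hi = minn (olcp lo (Some v)) (olcp (Some v) hi).
  case: lo hi Hlo Hhi {IHl IHr Hcla Hcra cv rv} => [p|] [q|] Hlo Hhi //=;
    rewrite ?min0n ?minn0 //.
  by apply: lcp_between; [exact: Hlo | exact: Hhi].
have Xm : olcp lo (Some v) <= m.
  case: lo rv {IHl IHr Hlo Hcra minE} => [p|] rv //=.
  by apply: (okmax DirRight); rewrite /= rv /= olcpC.
have Ym : olcp (Some v) hi <= m.
  case: hi cv {IHl IHr Hhi Hcla minE} => [p|] cv //=.
  by apply: (okmax DirLeft); rewrite /= cv.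
(* The side named by [d] has lcp [m]; the other lcp is at most [m], hence equals the minimum
   [olcp lo hi]. For [DirBot] all of them vanish. *)
have [-> ->] : (if is_left d then olcp lo hi else m) = olcp lo (Some v)
    /\ (if is_left d then m else olcp lo hi) = olcp (Some v) hi.
  case: d okm; rewrite /dir_lcp /is_left.
  - rewrite cv minE; case: hi Ym {IHl IHr Hhi Hcla minE cv} => //= q Ym [mE].
    by rewrite mE; split=> //; apply/minn_idPl.
  - rewrite rv minE; case: lo Xm {IHl IHr Hlo Hcra minE rv} => //= q Xm.
    by rewrite olcpC => -[mE]; rewrite mE; split=> //; apply/minn_idPr.
  - move=> [m0]; move: Xm Ym; rewrite minE -m0 !leqn0 => /eqP-> /eqP->.
    by rewrite minn0.
rewrite IHl //; last first.
- by move=> x p xl [<-]; apply: lv.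
- by move=> x p xl; apply: Hlo; apply: inl.
- by move=> x xl; rewrite Hcra ?inl // lr.
- by move=> x xl; rewrite Hcla ?inl // xl; case: (cla l x).
rewrite IHr //; last first.
- by move=> x p xr; apply: Hhi; apply: inr.
- by move=> x p xr [<-]; apply: vr.
- by move=> x xr; rewrite Hcra ?inr // xr; case: (cra r x).
- move=> x xr; rewrite Hcla ?inr //.
  by case xl: (x \in inorder l) => //; rewrite lr in xr.
(* [Some v] closes the list of the left subtree and opens that of the right one. *)
by rewrite map_cat rcons_cat /= -cat_rcons pairmap_cat last_rcons.
Qed.

(** Both delimiters are missing at the root, so the recursion starts from 0, and the gap before the
    smallest suffix yields SLCP[1] = 0. [take] drops the gap after the largest suffix. *)
Lemma gap_lcps_SLCP (t : tree) :
  all_nodes (pair_ok T t) t -> sorted slt (inorder t) ->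
  SLCP T (inorder t) = take (num_nodes t) (gap_lcps t 0).
Proof.
move=> ok srt; rewrite (@gap_lcpsE t t None None) //; first last.
- by rewrite -sorted_pairwise //; apply: suffix_lt_trans.
- by move=> v _; case: cra.
- by move=> v _; case: cla.
rewrite /num_nodes; case: (inorder t) {ok srt} => [|p s] //=; congr (_ :: _).
by elim: s p => //= q s IH p; rewrite -IH.
Qed.

End GapLcps.

(** * The RAM program *)

Lemma run_addn w prog j k s : run w prog (j + k) s = run w prog k (run w prog j s).
Proof.
elim: j s => //= j IH s; case E: (step w prog s) => [s'|]; first exact: IH.
by case: k {IH} => //= k; rewrite E.
Qed.

(* Registers: 0 current node, 1 output pointer, 2 current lcp, 3 stack pointer,
   4 and 5 the constants 1 and 0, 6 the last address, 7 start of the output. *)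
Definition slcp_prog : seq instr := [::
  (*  0 *) IConst 4 1;
           IConst 5 0;
           ISub 6 5 4;
           IMove 3 6;
           IMove 7 1;
           IMove 2 5;
  (*  6 *) IJumpEq 0 5 25;
           IAdd 8 0 4;
           IFetch 9 8;
           IAdd 8 8 4;
  (* 10 *) IFetch 10 8;
           IAdd 8 8 4;
           IFetch 11 8;
           IAdd 8 8 4;
           IFetch 12 8;
           IStore 3 10;
           ISub 3 3 4;
           IJumpEq 11 5 21;
           IStore 3 2;
           IMove 2 12;
  (* 20 *) IJump 22;
  (* 21 *) IStore 3 12;
  (* 22 *) ISub 3 3 4;
           IMove 0 9;
           IJump 6;
  (* 25 *) IStore 1 2;
           IAdd 1 1 4;
  (* 27 *) IJumpEq 3 6 33;
           IAdd 3 3 4;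
           IFetch 2 3;
           IAdd 3 3 4;
           IFetch 0 3;
           IJump 6;
  (* 33 *) IMove 0 7;
           IHalt].

(** * Word bounds and execution of single instructions *)

Lemma upd_bounded B f i x :
  (forall j, f j < B) -> x < B -> forall j, upd f i x j < B.
Proof. by move=> fB xB j; rewrite /upd; case: ifP. Qed.

Lemma sub1_mod w x : 0 < x -> x < 2 ^ w -> (x + (2 ^ w - 1)) %% 2 ^ w = x.-1.
Proof.
move=> x0 xw; have -> : x + (2 ^ w - 1) = x.-1 + 2 ^ w by lia.
by rewrite modnDr modn_small //; lia.
Qed.

Definition bounded w (R M : nat -> nat) : Prop :=
  [/\ 1 < 2 ^ w, forall r, R r < 2 ^ w & forall a, M a < 2 ^ w].

Definition consts w (R : nat -> nat) : Prop :=
  [/\ R 4 = 1, R 5 = 0 & R 6 = (2 ^ w).-1].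

Section Instructions.
Variables (w : nat) (prog : seq instr) (p : nat) (R M : nat -> nat).

Lemma run_const r c k : nth IHalt prog p = IConst r c -> c < 2 ^ w ->
  run w prog k.+1 (State p R M) = run w prog k (State p.+1 (upd R r c) M).
Proof. by move=> E lt; rewrite /= /step /= E modn_small. Qed.

(** The written value is a separate argument [x], so that a caller can give it in simplified form
    instead of as a nest of [upd]. *)
Lemma run_move r a k x : nth IHalt prog p = IMove r a -> R a = x -> x < 2 ^ w ->
  run w prog k.+1 (State p R M) = run w prog k (State p.+1 (upd R r x) M).
Proof. by move=> E <- lt; rewrite /= /step /= E modn_small. Qed.

Lemma run_iadd r a b k x :
  nth IHalt prog p = IAdd r a b -> R a + R b = x -> x < 2 ^ w ->
  run w prog k.+1 (State p R M) = run w prog k (State p.+1 (upd R r x) M).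
Proof. by move=> E <- lt; rewrite /= /step /= E modn_small. Qed.

Lemma run_isub r a b k x :
  nth IHalt prog p = ISub r a b -> (R a + (2 ^ w - R b)) %% 2 ^ w = x ->
  run w prog k.+1 (State p R M) = run w prog k (State p.+1 (upd R r x) M).
Proof. by move=> E <-; rewrite /= /step /= E. Qed.

Lemma run_fetch r a k x :
  nth IHalt prog p = IFetch r a -> M (R a) = x -> x < 2 ^ w ->
  run w prog k.+1 (State p R M) = run w prog k (State p.+1 (upd R r x) M).
Proof. by move=> E <- lt; rewrite /= /step /= E modn_small. Qed.

Lemma run_store a b k x y :
  nth IHalt prog p = IStore a b -> R a = x -> R b = y ->
  run w prog k.+1 (State p R M) = run w prog k (State p.+1 R (upd M x y)).
Proof. by move=> E <- <-; rewrite /= /step /= E. Qed.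

Lemma run_jump l k : nth IHalt prog p = IJump l ->
  run w prog k.+1 (State p R M) = run w prog k (State l R M).
Proof. by move=> E; rewrite /= /step /= E. Qed.

Lemma run_jumpeq a b l k (c : bool) :
  nth IHalt prog p = IJumpEq a b l -> (R a == R b) = c ->
  run w prog k.+1 (State p R M) = run w prog k (State (if c then l else p.+1) R M).
Proof. by move=> E <-; rewrite /= /step /= E. Qed.

End Instructions.

(** * Segments of the program *)

Ltac regs := solve [by [] | by rewrite /upd /=; (done || lia || congruence)].

Lemma run_load w R M b l v d m r :
  bounded w R M -> consts w R -> 0 < R 3 -> b <= 2 ^ w ->
  stored M b (R 0) (Node l v d m r) ->
  exists R',
  [/\ run w slcp_prog 11 (State 6 R M) =
        State 17 R' (upd M (R 3) (M (R 0 + 2))),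
      consts w R',
      (forall r, R' r < 2 ^ w),
      [/\ R' 1 = R 1, R' 2 = R 2, R' 3 = (R 3).-1 & R' 7 = R 7]
    & [/\ R' 9 = M (R 0 + 1), R' 11 = dir_code d & R' 12 = m]].
Proof.
move=> [w1 RB MB] [R4 R5 R6] R30 bw [[a0 ab] [Mv Md Mm] _ _].
have [RB3 mB] : R 3 < 2 ^ w /\ m < 2 ^ w by rewrite -Mm.
have dB : dir_code d < 2 ^ w by rewrite -Md.
eexists; split.
- rewrite (@run_jumpeq _ _ _ _ _ 0 5 25 _ false); [|regs|by rewrite R5; lia].
  rewrite (@run_iadd _ _ _ _ _ 8 0 4 _ (R 0 + 1)); [|regs..].
  rewrite (@run_fetch _ _ _ _ _ 9 8 _ (M (R 0 + 1))); [|regs..].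
  rewrite (@run_iadd _ _ _ _ _ 8 8 4 _ (R 0 + 2)); [|regs..].
  rewrite (@run_fetch _ _ _ _ _ 10 8 _ (M (R 0 + 2))); [|regs..].
  rewrite (@run_iadd _ _ _ _ _ 8 8 4 _ (R 0 + 3)); [|regs..].
  rewrite (@run_fetch _ _ _ _ _ 11 8 _ (dir_code d)); [|regs..].
  rewrite (@run_iadd _ _ _ _ _ 8 8 4 _ (R 0 + 4)); [|regs..].
  rewrite (@run_fetch _ _ _ _ _ 12 8 _ m); [|regs..].
  rewrite (@run_store _ _ _ _ _ 3 10 _ (R 3) (M (R 0 + 2))); [|regs..].
  rewrite (@run_isub _ _ _ _ _ 3 3 4 _ (R 3).-1); [by []|regs|].
  by rewrite /upd /= R4 sub1_mod.
- by split.
- by repeat apply: upd_bounded => //; lia.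
- by split.
- by split.
Qed.

(** A stack frame has two words: the right pointer and, one address below, the lcp with which the
    right subtree is to be entered. The bound is 11 steps of [run_load] plus 5 or 7 for the
    branches. *)
Lemma run_node w R M b l v d m r :
  bounded w R M -> consts w R -> 1 < R 3 -> b <= 2 ^ w ->
  stored M b (R 0) (Node l v d m r) ->
  exists k R',
  [/\ k <= 18,
      run w slcp_prog k (State 6 R M) =
        State 6 R' (upd (upd M (R 3) (M (R 0 + 2))) (R 3).-1
                        (if is_left d then m else R 2)),
      consts w R',
      (forall r, R' r < 2 ^ w)
    & [/\ R' 0 = M (R 0 + 1), R' 1 = R 1, R' 2 = if is_left d then R 2 else m,
          R' 3 = (R 3).-2 & R' 7 = R 7]].
Proof.
move=> bnd cst R31 bw st.
have [R' [E [R4 R5 R6] RB [R1 R2 R3 R7] [R9 R11 R12]]] :=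
  run_load bnd cst (ltnW R31) bw st.
have [w1 RB0 MB] := bnd.
have [RB2 RB3] : R 2 < 2 ^ w /\ R 3 < 2 ^ w by [].
have mB : m < 2 ^ w by rewrite -R12.
(* [dir_code] is 0 exactly for [DirLeft]. *)
have jE : (R' 11 == R' 5) = is_left d by rewrite R11 R5; case: (d).
exists (11 + if is_left d then 5 else 7).
case: is_left jE => jE; (eexists; split; first by [];
  [rewrite run_addn E (@run_jumpeq _ _ _ _ _ 11 5 21 _ _ _ jE); [|regs]|..]).
- rewrite (@run_store _ _ _ _ _ 3 12 _ (R 3).-1 m); [|regs..].
  rewrite (@run_isub _ _ _ _ _ 3 3 4 _ (R 3).-2); [|regs|]; last first.
    by rewrite R4 R3 sub1_mod //; lia.
  rewrite (@run_move _ _ _ _ _ 0 9 _ (M (R 0 + 1))); [|regs..].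
  by rewrite (@run_jump _ _ _ _ _ 6).
- by split.
- by repeat apply: upd_bounded => //; lia.
- by split.
- rewrite (@run_store _ _ _ _ _ 3 2 _ (R 3).-1 (R 2)); [|regs..].
  rewrite (@run_move _ _ _ _ _ 2 12 _ m); [|regs..].
  rewrite (@run_jump _ _ _ _ _ 22); [|regs..].
  rewrite (@run_isub _ _ _ _ _ 3 3 4 _ (R 3).-2); [|regs|]; last first.
    by rewrite /upd /= R4 R3 sub1_mod //; lia.
  rewrite (@run_move _ _ _ _ _ 0 9 _ (M (R 0 + 1))); [|regs..].
  by rewrite (@run_jump _ _ _ _ _ 6).
- by split.
- by repeat apply: upd_bounded => //; lia.
- by split.
Qed.

Lemma run_leaf w R M :
  consts w R -> R 0 = 0 -> (R 1).+1 < 2 ^ w ->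
  run w slcp_prog 3 (State 6 R M) =
    State 27 (upd R 1 (R 1).+1) (upd M (R 1) (R 2)).
Proof.
move=> [R4 R5 R6] R0 R1.
rewrite (@run_jumpeq _ _ _ _ _ 0 5 25 _ true); [|regs|by rewrite R5 R0].
rewrite (@run_store _ _ _ _ _ 1 2 _ (R 1) (R 2)); [|regs..].
by rewrite (@run_iadd _ _ _ _ _ 1 1 4 _ (R 1).+1) // R4 addn1.
Qed.

Lemma run_pop w R M :
  bounded w R M -> consts w R -> (R 3).+2 < 2 ^ w ->
  exists R',
  [/\ run w slcp_prog 6 (State 27 R M) = State 6 R' M,
      consts w R',
      (forall r, R' r < 2 ^ w)
    & [/\ R' 0 = M (R 3).+2, R' 1 = R 1, R' 2 = M (R 3).+1,
          R' 3 = (R 3).+2 & R' 7 = R 7]].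
Proof.
move=> [w1 RB MB] [R4 R5 R6] R3; eexists; split.
(* The stack is empty when its pointer is the last address, which the bound on [R 3] excludes. *)
- rewrite (@run_jumpeq _ _ _ _ _ 3 6 33 _ false); [|regs|by rewrite R6; lia].
  rewrite (@run_iadd _ _ _ _ _ 3 3 4 _ (R 3).+1); [|regs..].
  rewrite (@run_fetch _ _ _ _ _ 2 3 _ (M (R 3).+1)); [|regs..].
  rewrite (@run_iadd _ _ _ _ _ 3 3 4 _ (R 3).+2); [|regs..].
  rewrite (@run_fetch _ _ _ _ _ 0 3 _ (M (R 3).+2)); [|regs..].
  by rewrite (@run_jump _ _ _ _ _ 6).
- by split.
- by repeat apply: upd_bounded => //; lia.
- by split.
Qed.

Lemma stored_ext M M' b a t :
  (forall x, x < b -> M' x = M x) -> stored M b a t -> stored M' b a t.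
Proof.
move=> MM'; elim: t a => //= l IHl v d m r IHr a [ab [Mv Md Mm] sl sr].
by rewrite !MM'; [split; auto | lia ..].
Qed.

(** A node accounts for 18 steps of [run_node], 6 of [run_pop] and 3 for an absent subtree, of which
    there is one more than nodes. Its three words of space are an output entry and a frame. Leaving
    memory outside the addresses from [R 1] to [R 3] unchanged protects the tree below and the
    pending frames above. *)
Lemma run_tree w b t R M :
  bounded w R M -> consts w R -> stored M b (R 0) t ->
  b <= R 1 -> R 1 + 3 * num_nodes t < R 3 ->
  exists k R' M',
  [/\ k <= 27 * num_nodes t + 3 /\
        run w slcp_prog k (State 6 R M) = State 27 R' M',
      bounded w R' M' /\ consts w R',
      [/\ R' 1 = R 1 + (num_nodes t).+1, R' 3 = R 3 & R' 7 = R 7],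
      (forall x, x < R 1 \/ R 3 < x -> M' x = M x)
    & forall i, i <= num_nodes t -> M' (R 1 + i) = nth 0 (gap_lcps t (R 2)) i].
Proof.
elim: t R M => [|l IHl v d m r IHr] R M bnd cst st bR1 space.
  have [w1 RB MB] := bnd; have RB3 := RB 3.
  have R1 : (R 1).+1 < 2 ^ w by move: space; rewrite /num_nodes /=; lia.
  exists 3, (upd R 1 (R 1).+1), (upd M (R 1) (R 2)); split.
  - by rewrite run_leaf.
  - by split; [split=> //; apply: upd_bounded | case: cst].
  - by split; rewrite /upd //= addn1.
  - by move=> x xR; rewrite /upd ifF //; move: space; rewrite /num_nodes /=; lia.
  - by move=> [|i] //; rewrite addn0 /upd eqxx.
have nE : num_nodes (Node l v d m r) = num_nodes l + (num_nodes r).+1.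
  by rewrite /num_nodes /= size_cat.
rewrite nE in space *.
have [w1 RB MB] := bnd; have RB3 := RB 3.
have [||k1 [R1 [k1B E1 cst1 RB1 [R10 R11 R12 R13 R17]]]] :=
  run_node bnd cst _ _ st; [lia..|].
set M1 := upd _ _ _ in E1.
have [_ [_ _ Mm] sl sr] := st.
have MB1 : forall x, M1 x < 2 ^ w.
  by repeat apply: upd_bounded => //; case: is_left => //; rewrite -Mm.
have M1E x : x < (R 3).-1 \/ R 3 < x -> M1 x = M x.
  by move=> xR; rewrite /M1 /upd !ifF //; lia.
have sl1 : stored M1 b (R1 0) l.
  by rewrite R10; apply: stored_ext sl => x xb; apply: M1E; lia.
have bnd1 : bounded w R1 M1 by [].
have [||k2 [R2 [M2 [[k2B E2] [bnd2 cst2] [R21 R23 R27] M2E out2]]]] :=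
  IHl R1 M1 bnd1 cst1 sl1; [lia..|].
rewrite R11 R12 R13 in out2 R21 R23 M2E.
have [|R3 [E3 cst3 RB3' [R30 R31 R32 R33 R37]]] := run_pop bnd2 cst2; first lia.
have spE : R2 3 = (R 3).-2 by [].
(* The frame pushed for [r] lies above the stack pointer with which [l] is entered, so it is still
   intact. *)
have M2sp : M2 (R 3) = M (R 0 + 2).
  by rewrite M2E ?/M1 ?/upd ?eqxx ?ifF //; lia.
have M2sp1 : M2 (R 3).-1 = if is_left d then m else R 2.
  by rewrite M2E ?/M1 ?/upd ?eqxx //; lia.
have sp1 : (R 3).-2.+1 = (R 3).-1 by lia.
have sp2 : (R 3).-1.+1 = R 3 by lia.
rewrite spE sp1 ?sp2 M2sp M2sp1 in R30 R32 R33.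
have [_ _ MB2] := bnd2.
have sr3 : stored M2 b (R3 0) r.
  rewrite R30; apply: stored_ext sr => x xb; rewrite M2E; last by lia.
  by apply: M1E; lia.
have bnd3 : bounded w R3 M2 by [].
have [||k4 [R4 [M4 [[k4B E4] bnd4 [R41 R43 R47] M4E out4]]]] :=
  IHr R3 M2 bnd3 cst3 sr3; [lia..|].
rewrite R31 R21 R32 R33 in out4 R41 R43 M4E.
exists (k1 + (k2 + (6 + k4))), R4, M4; split=> //.
- by split; [lia | rewrite run_addn E1 run_addn E2 run_addn E3 E4].
- by split; [lia | | congruence].
- move=> x xR; rewrite M4E; last by lia.
  by rewrite M2E ?M1E //; lia.
- move=> i iB /=; rewrite nth_cat size_gap_lcps; case: ltnP => il.
    (* The entries of [l] lie below the output pointer with which [r] is entered. *)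
    by rewrite M4E ?out2 //; lia.
  rewrite -out4; last by lia.
  by congr (M4 _); lia.
Qed.

Theorem theorem3 :
  exists (prog : seq instr) (c : nat),
  forall (disp : Order.disp_t) (A : orderType disp) (T : seq A)
    (P ssa : seq nat) (t : tree),
  uniq P ->
  (forall p, p \in P -> 1 <= p <= size T) ->
  is_SSA T P ssa ->
  is_SAVL T P t ->
  forall (w : nat) (s : state),
  input_state w t s ->
  (* w-bit addresses reach a free memory of size linear in the number of nodes *)
  reg s 1 + c * (num_nodes t).+1 <= 2 ^ w ->
  exists k : nat,
  [/\ k <= c * (num_nodes t).+1,
      halted w prog (run w prog k s)
    & output_array w (SLCP T ssa) (run w prog k s)].
Proof.
(* For n nodes the traversal takes at most 27n + 3 steps, and 6 + 2 more surround it; 27 (n + 1)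
   covers this and the 3 words of space per node. *)
exists slcp_prog, 27 => disp A T P ssa t _ _ /andP[permP srt] [/andP[permP' srt'] ok].
(* A strict order sorts a given set of positions in only one way. *)
have -> : ssa = inorder t.
  apply: (irr_sorted_eq (@suffix_lt_trans _ _ T) (@suffix_ltxx _ _ T)) => //.
  by move=> x; rewrite (perm_mem permP) (perm_mem permP').
move=> w [p R M] [/= -> RB MB st] space.
have w1 : 1 < 2 ^ w by lia.
pose R0 := upd (upd (upd (upd (upd (upd R 4 1) 5 0) 6 (2 ^ w).-1) 3 (2 ^ w).-1)
               7 (R 1)) 2 0.
have E0 : run w slcp_prog 6 (State 0 R M) = State 6 R0 M.
  rewrite (@run_const _ _ _ _ _ 4 1); [|regs..].
  rewrite (@run_const _ _ _ _ _ 5 0); [|regs..].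
  (* Computing 0 - 1 wraps around to the last address, so a program independent of [w] finds the top
     of memory. *)
  rewrite (@run_isub _ _ _ _ _ 6 5 4 _ (2 ^ w).-1); [|regs|]; last first.
    by rewrite /upd /= add0n subn1 modn_small //; lia.
  rewrite (@run_move _ _ _ _ _ 3 6 _ (2 ^ w).-1); [|regs..].
  rewrite (@run_move _ _ _ _ _ 7 1 _ (R 1)); [|regs..].
  by rewrite (@run_move _ _ _ _ _ 2 5 _ 0) //; lia.
have bnd0 : bounded w R0 M.
  by split=> //; repeat apply: upd_bounded => //; lia.
have cst0 : consts w R0 by [].
have [|k [R1 [M1 [[kB E1] [[_ RB1 MB1] [R14 R15 R16]] [R11 R13 R17] _ out]]]] :=
  run_tree bnd0 cst0 st (leqnn _); first by rewrite /R0 /upd /=; lia.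
rewrite /R0 /upd /= in R11 R13 R17 out.
have E2 : run w slcp_prog 2 (State 27 R1 M1) = State 34 (upd R1 0 (R 1)) M1.
  rewrite (@run_jumpeq _ _ _ _ _ 3 6 33 _ true); [|regs|by rewrite R13 R16 eqxx].
  by rewrite (@run_move _ _ _ _ _ 0 7 _ (R 1)).
exists (6 + (k + 2)); rewrite run_addn E0 run_addn E1 E2; split=> //; first by lia.
(* The traversal has written one entry more than SLCP has; it lies just past the end of the output
   array. *)
rewrite (gap_lcps_SLCP ok srt').
have szE : size (take (num_nodes t) (gap_lcps t 0)) = num_nodes t.
  by rewrite size_takel // size_gap_lcps.
rewrite /output_array szE /upd /=; split=> [|i iB]; first by lia.
by rewrite nth_take // out // ltnW.
Qed.
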